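(* Let (W) be any one of the properties (A1e)–(C2) listed in the context. (1) If $\mathbf Q$ is a poset with an operation satisfying (W) and $\iota$ is an order-embedding of $\mathbf Q$ into some bounded complete lattice $\mathbf P$, then $\mathbf P$ can be expanded by adding an operation satisfying (W) in such a way that $\iota$ is an embedding with respect to the operation. (2) Every poset $\mathbf Q$ with an operation satisfying (W) can be order-embedded into some complete bounded lattice $\mathbf P$ with an operation satisfying (W), in such a way that the embedding preserves the operation and all existing, possibly infinitary, meets and joins in $\mathbf Q$. (3) Every poset with an operation satisfying (W) can be order-embedded into some complete atomic Boolean algebra with an operation satisfying (W), in such a way that the embedding preserves the operation and all existing, possibly infinitary, meets (alternatively, joins). (4) Every distributive lattice with an operation satisfying (W) can be lattice-embedded into some complete atomic Boolean lattice with an operation satisfying (W), in such a way that the embedding also preserves the operation. (5) In each of the cases (1), (2), (3) and (4) of the present statement, in place of a single operation satisfying (W), one can add simultaneously any number of operations, possibly of distinct arities, and possibly satisfying distinct properties chosen from (A1e)–(C2). The construction can be performed in such a way that it preserves comparability conditions among operations satisfying the same property.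
   Context: Properties of an operation on an ordered structure. For a unary operation $K$: (A1e) extensive ($x\le Kx$ for all $x$); (A1c) contractive ($Kx\le x$ for all $x$); (A2) idempotent ($KKx=Kx$ for all $x$); (A2e) idempotent and extensive; (A2c) idempotent and contractive; (A3) involutive ($KKx=x$ for all $x$); (B1) isotone ($x\le y$ implies $Kx\le Ky$); (B1e) isotone and extensive; (B1c) isotone and contractive; (B2) isotone and idempotent; (B3) a closure operation (isotone, extensive and idempotent); (B4) an interior operation (isotone, contractive and idempotent); (B5) antitone ($x\le y$ implies $Ky\le Kx$). For an $n$-ary operation $F$ ($n\ge 1$, $i,j\ge 0$, $i+j\le n$): (C1)$_{i,j,n}$ $F$ is isotone on the first $i$ components and antitone on the last $j$ components (each component being varied with the other arguments fixed); (C2)$_{i,j,n,h}$ $F$ satisfies (C1)$_{i,j,n}$ and moreover $x_1\le F\bar x,\dots,x_h\le F\bar x$ for all $\bar x$, where $h\le i$ is fixed. No additivity or multiplicativity is assumed for closure and interior operations. A comparability condition between two operations $H,K$ of the same arity on the same set is a condition of the form ''$H\bar x\le K\bar x$ for every $\bar x$'' (strict inequalities are not considered). ''Complete'' is meant in the lattice-theoretical sense. A lattice-embedding is an embedding preserving the binary lattice operations. *)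

(* Defs.v *)
From mathcomp Require Import all_boot all_order.
From mathcomp Require Import boolp classical_sets.
Set Implicit Arguments.
Unset Strict Implicit.
Unset Printing Implicit Defensive.
Import Order.TTheory.
Local Open Scope classical_set_scope.
Local Open Scope order_scope.

(* The constraints on the parameters of (C1) and (C2) are carried by the
   constructors, so that every inhabitant is a legitimate property. *)
Inductive property : Type :=
| A1e | A1c | A2 | A2e | A2c | A3
| B1 | B1e | B1c | B2 | B3 | B4 | B5
| C1 (i j n : nat) of (0 < n)%N & (i + j <= n)%N
| C2 (i j n h : nat) of (0 < n)%N & (i + j <= n)%N & (h <= i)%N.

Definition arity (w : property) : nat :=
  match w with
  | C1 _ _ n _ _ => n
  | C2 _ _ n _ _ _ _ => n
  | _ => 1
  end.

Definition operation (n : nat) (T : Type) : Type := ('I_n -> T) -> T.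

Definition unary (T : Type) (F : operation 1 T) (x : T) : T := F (fun=> x).

Section Properties.
Context {d : Order.disp_t} {T : porderType d}.

Definition extensive (K : T -> T) : Prop := forall x, x <= K x.
Definition contractive (K : T -> T) : Prop := forall x, K x <= x.
Definition isotone (K : T -> T) : Prop := {homo K : x y / x <= y}.
Definition antitone (K : T -> T) : Prop := {homo K : x y /~ x <= y}.

Definition agree_off (n : nat) (k : 'I_n) (x y : 'I_n -> T) : Prop :=
  forall l, l != k -> x l = y l.

Definition isotone_at (n : nat) (F : operation n T) (k : 'I_n) : Prop :=
  forall x y, agree_off k x y -> x k <= y k -> F x <= F y.
Definition antitone_at (n : nat) (F : operation n T) (k : 'I_n) : Prop :=
  forall x y, agree_off k x y -> x k <= y k -> F y <= F x.

(* Components are numbered from 0: the first i are those with k < i, and the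
   last j are those with n - j <= k. *)
Definition mixed_monotone (i j n : nat) (F : operation n T) : Prop :=
  (forall k : 'I_n, (k < i)%N -> isotone_at F k) /\
  (forall k : 'I_n, (n - j <= k)%N -> antitone_at F k).

Definition satisfies (w : property) : operation (arity w) T -> Prop :=
  match w return operation (arity w) T -> Prop with
  | A1e => fun F => extensive (unary F)
  | A1c => fun F => contractive (unary F)
  | A2  => fun F => idempotent_fun (unary F)
  | A2e => fun F => idempotent_fun (unary F) /\ extensive (unary F)
  | A2c => fun F => idempotent_fun (unary F) /\ contractive (unary F)
  | A3  => fun F => involutive (unary F)
  | B1  => fun F => isotone (unary F)
  | B1e => fun F => isotone (unary F) /\ extensive (unary F)
  | B1c => fun F => isotone (unary F) /\ contractive (unary F)
  | B2  => fun F => isotone (unary F) /\ idempotent_fun (unary F)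
  | B3  => fun F =>
      [/\ isotone (unary F), extensive (unary F) & idempotent_fun (unary F)]
  | B4  => fun F =>
      [/\ isotone (unary F), contractive (unary F) & idempotent_fun (unary F)]
  | B5  => fun F => antitone (unary F)
  | C1 i j n _ _ => fun F => mixed_monotone i j F
  | C2 i j n h _ _ _ => fun F =>
      mixed_monotone i j F /\ (forall (k : 'I_n) x, (k < h)%N -> x k <= F x)
  end.

Definition complete : Prop :=
  forall A : set T, supremums A !=set0 /\ infimums A !=set0.

End Properties.
Arguments complete {d} T.

Definition atom (d : Order.disp_t) (P : bPOrderType d) (a : P) : Prop :=
  a != \bot /\ forall x : P, x < a -> x = \bot.

Definition atomic (d : Order.disp_t) (P : bPOrderType d) : Prop :=
  forall x : P, x != \bot -> exists2 a : P, atom a & a <= x.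

Definition complete_atomic (d : Order.disp_t) (P : ctbDistrLatticeType d) : Prop :=
  complete P /\ atomic P.

Section Embeddings.
Context {d d' : Order.disp_t}.

Definition order_embedding (Q : porderType d) (P : porderType d')
  (f : Q -> P) : Prop := {mono f : x y / x <= y}.

(* No condition is imposed on a top or bottom element of Q, if any. *)
Definition lattice_embedding (Q : latticeType d) (P : latticeType d')
    (f : Q -> P) : Prop :=
  [/\ order_embedding f,
      {morph f : x y / x `&` y} & {morph f : x y / x `|` y}].

(* A ranges over all subsets of Q, so that a least (resp. greatest) element
   of Q is preserved as the join (resp. meet) of the empty set. *)
Definition preserves_joins (Q : porderType d) (P : porderType d')
    (f : Q -> P) : Prop :=
  forall (A : set Q) (s : Q), supremums A s -> supremums (f @` A) (f s).
Definition preserves_meets (Q : porderType d) (P : porderType d')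
    (f : Q -> P) : Prop :=
  forall (A : set Q) (s : Q), infimums A s -> infimums (f @` A) (f s).

End Embeddings.

Definition preserves_operation (n : nat) (Q P : Type) (f : Q -> P)
    (F : operation n Q) (G : operation n P) : Prop :=
  forall x : 'I_n -> Q, f (F x) = G (f \o x).

(* For each property w, I w indexes the operations that are assigned w. *)
Definition operations (I : property -> Type) (T : Type) : Type :=
  forall w : property, I w -> operation (arity w) T.

Definition all_satisfy (I : property -> Type) (d : Order.disp_t)
    (T : porderType d) (F : operations I T) : Prop :=
  forall (w : property) (k : I w), satisfies (F w k).

Definition preserves_operations (I : property -> Type) (Q P : Type)
    (f : Q -> P) (F : operations I Q) (G : operations I P) : Prop :=
  forall (w : property) (k : I w), preserves_operation f (F w k) (G w k).

Definition preserves_comparabilities (I : property -> Type)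
    (d d' : Order.disp_t) (Q : porderType d) (P : porderType d')
    (F : operations I Q) (G : operations I P) : Prop :=
  forall (w : property) (k l : I w),
    (forall x, F w k x <= F w l x) -> forall x, G w k x <= G w l x.

(* Main.v *)
From HB Require Import structures.
Require Import Defs.
From mathcomp Require Import all_boot all_order.
From mathcomp Require Import boolp classical_sets.
Set Implicit Arguments.
Unset Strict Implicit.
Unset Printing Implicit Defensive.
Import Order.TTheory.
Local Open Scope classical_set_scope.
Local Open Scope order_scope.

(** The operation and the lattice can be treated separately.  For each property
    w there is a canonical recipe, [extend], that carries an operation on Q
    along an arbitrary order-embedding iota of Q into a complete lattice P.
    Whatever else iota preserves is a matter of choosing iota, and is not
    disturbed by the recipe.

    The recipes are the following.  Properties A1e to A3 relate an argument to
    the iterates of the operation at that argument only, so the identity may be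
    used outside the image of iota.  For the (mixed) monotone operations one takes
    the least monotone extension, p |-> sup {iota (F x) | x below p}, where
    below is read with the order reversed on antitone arguments, and one joins
    to it the arguments that the value must dominate.  The unary properties B1,
    B1e and B5 are instances of the mixed ones, and this least extension of a
    contractive (interior) operation is again contractive (interior).
    It does not keep idempotence in the absence of contractivity; closure
    operations are extended instead through their closed points,
    p |-> inf {iota c | K c = c, p <= iota c}, and isotone idempotent
    operations by a combination of both ideas: one takes the closed points c
    above all values K x with iota x <= p.  All recipes are isotone in the
    operation that is extended (on operations satisfying w), which is why
    comparabilities survive; and as they act on one operation at a time, any
    family of operations can be extended simultaneously.

    The embeddings are classical.  All existing meets and joins are preserved by
    the Dedekind-MacNeille completion; x |-> {y | y <= x} embeds Q into its
    powerset with all meets, and x |-> {y | ~ x <= y} with all joins; a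
    distributive lattice embeds into the powerset of its prime filters, by the
    prime filter theorem. *)

(** * Suprema and infima in complete lattices *)

Section CompleteLattices.
Context {d : Order.disp_t} {T : tbLatticeType d}.
Hypothesis T_complete : complete T.
Implicit Types (A B : set T) (x y : T).

Lemma supremumsP A : supremums A (supremum \bot A).
Proof.
rewrite /supremum; case: eqP => [->|_]; last first.
  by have [[s As] _] := T_complete A; exact: xgetI As.
by split=> [x []|x _]; exact: le0x.
Qed.

Lemma infimumsP A : infimums A (infimum \top A).
Proof.
rewrite /infimum; case: eqP => [->|_]; last first.
  by have [_ [s As]] := T_complete A; exact: xgetI As.
by split=> [x []|x _]; exact: lex1.
Qed.

Lemma le_supremum A x : A x -> x <= supremum \bot A.
Proof. by case: (supremumsP A) => + _; apply. Qed.

Lemma supremum_le A y : ubound A y -> supremum \bot A <= y.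
Proof. by case: (supremumsP A) => _; apply. Qed.

Lemma infimum_le A x : A x -> infimum \top A <= x.
Proof. by case: (infimumsP A) => + _; apply. Qed.

Lemma le_infimum A y : lbound A y -> y <= infimum \top A.
Proof. by case: (infimumsP A) => _; apply. Qed.

End CompleteLattices.

Lemma supremum_max (d : Order.disp_t) (T : porderType d) (z m : T)
  (A : set T) : A m -> ubound A m -> supremum z A = m.
Proof.
move=> Am mA; rewrite /supremum; case: eqP => [A0|_].
  by move: Am; rewrite A0.
by apply: xget_subset1; [split=> // y; exact|exact: is_subset1_supremums].
Qed.

Lemma infimum_min (d : Order.disp_t) (T : porderType d) (z m : T)
  (A : set T) : A m -> lbound A m -> infimum z A = m.
Proof.
move=> Am mA; rewrite /infimum; case: eqP => [A0|_].
  by move: Am; rewrite A0.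
by apply: xget_subset1; [split=> // y; exact|exact: is_subset1_infimums].
Qed.

(** * Unary properties as instances of mixed monotony *)

Lemma ord1_tuple (T : Type) (x : 'I_1 -> T) : x = fun=> x ord0.
Proof. by apply/funext => k; rewrite ord1. Qed.

Lemma unaryE (T : Type) (F : operation 1 T) x : unary F (x ord0) = F x.
Proof. by rewrite /unary -ord1_tuple. Qed.

Section UnaryMonotony.
Context {d : Order.disp_t} {T : porderType d}.
Implicit Types F : operation 1 T.

Lemma isotone_unaryP F : isotone (unary F) <-> mixed_monotone 1 0 F.
Proof.
split=> [Fi|[Fi _] x y xy]; last by apply: (Fi ord0) => // l; rewrite ord1.
split=> [k _ x y _|k]; last by rewrite subn0 leqNgt ltn_ord.
by rewrite ord1 => /Fi; rewrite !unaryE.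
Qed.

Lemma antitone_unaryP F : antitone (unary F) <-> mixed_monotone 0 1 F.
Proof.
split=> [Fa|[_ Fa] x y xy]; last by apply: (Fa ord0) => // l; rewrite ord1.
by split=> // k _ x y _; rewrite ord1 => /Fa; rewrite !unaryE.
Qed.

Lemma extensive_unaryP F :
  extensive (unary F) <-> forall (k : 'I_1) x, (k < 1)%N -> x k <= F x.
Proof.
split=> [Fe k x _|Fe x]; last by apply: (Fe ord0 (fun=> x)).
by rewrite ord1 -unaryE.
Qed.

End UnaryMonotony.

(** * Mixed monotone operations *)

Definition mixed_le (d : Order.disp_t) (T : porderType d) (i j n : nat)
    (x y : 'I_n -> T) : Prop :=
  forall k : 'I_n, [/\ (k < i)%N -> x k <= y k,
                       (n - j <= k)%N -> y k <= x k &
                       (i <= k < n - j)%N -> x k = y k].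

(** Mixed monotony varies one argument at a time; x is turned into y by changing
    the coordinates from left to right, and no step decreases the value. *)
Lemma mixed_monotone_le (d : Order.disp_t) (T : porderType d) (i j n : nat)
  (F : operation n T) (x y : 'I_n -> T) :
  mixed_monotone i j F -> mixed_le i j x y -> F x <= F y.
Proof.
move=> [Fi Fa] xy.
pose z m (k : 'I_n) := if (k < m)%N then y k else x k.
have step m : (m <= n)%N -> F x <= F (z m).
  elim: m => [_|m IH lmn].
    by rewrite (_ : z 0 = x) //; apply/funext.
  apply: le_trans (IH (ltnW lmn)) _.
  pose k := Ordinal lmn.
  have zoff : agree_off k (z m) (z m.+1).
    move=> l; rewrite -val_eqE /= /z => lm.
    by rewrite ltnS [(l <= m)%N]leq_eqVlt (negbTE lm).
  have zm : z m k = x k by rewrite /z ltnn.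
  have zm1 : z m.+1 k = y k by rewrite /z ltnSn.
  have [xy1 xy2 xy3] := xy k.
  have [ki|ik] := ltnP k i; first by apply: (Fi k) => //; rewrite zm zm1 xy1.
  have [jk|kj] := leqP (n - j) k.
    apply: (Fa k) => //; last by rewrite zm zm1 xy2.
    by move=> l lk; rewrite zoff.
  rewrite (_ : z m.+1 = z m) //; apply/funext => l.
  have [->|/zoff->//] := eqVneq l k.
  by rewrite zm zm1 xy3 // ik.
apply: le_trans (step n (leqnn n)) _.
by rewrite (_ : z n = y) //; apply/funext => k; rewrite /z ltn_ord.
Qed.

(** * Extending operations along an order-embedding *)

Section Extension.
Context {d d' : Order.disp_t} {Q : porderType d} {P : tbLatticeType d'}.
Variable iota : Q -> P.
Hypothesis iota_embedding : order_embedding iota.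
Hypothesis P_complete : complete P.

Let iota_inj : injective iota.
Proof. exact: inc_inj. Qed.

Definition unary_operation (E : P -> P) : operation 1 P := fun p => E (p ord0).

Definition identity_extension (K : Q -> Q) (p : P) : P :=
  xget p [set iota (K x) | x in [set x | iota x = p]].

(** The least value compatible with mixed monotony, corrected from below by the
    first h arguments so that the value dominates them. *)
Definition mixed_extension (i j h n : nat) (F : operation n Q) :
    operation n P :=
  fun p => supremum \bot
    ([set iota (F x) | x in [set x | mixed_le i j (iota \o x) p]] `|`
     [set p k | k in [set k : 'I_n | (k < h)%N]]).

(** The supremum of the values K x with iota x <= p is an isotone extension, but
    that supremum may lie above new points of the image of iota, so that it need
    not be fixed by a second application.  It is therefore rounded up
    to an infimum of fixed points of K; the points iota x below the result are
    then mapped below the same fixed points. *)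
Definition retraction_extension (K : Q -> Q) (p : P) : P :=
  infimum \top [set iota c | c in
    [set c | K c = c /\ forall x, iota x <= p -> K x <= c]].

(** The closure operation on P whose closed points are the infima of images of
    closed points of Q. *)
Definition closure_extension (K : Q -> Q) (p : P) : P :=
  infimum \top [set iota c | c in [set c | K c = c /\ p <= iota c]].

Definition extend (w : property) :
    operation (arity w) Q -> operation (arity w) P :=
  match w return operation (arity w) Q -> operation (arity w) P with
  | A1e | A1c | A2 | A2e | A2c | A3 =>
      fun F => unary_operation (identity_extension (unary F))
  | B1 | B1c | B4 => mixed_extension 1 0 0 (n := 1)
  | B1e => mixed_extension 1 0 1 (n := 1)
  | B2 => fun F => unary_operation (retraction_extension (unary F))
  | B3 => fun F => unary_operation (closure_extension (unary F))
  | B5 => mixed_extension 0 1 0 (n := 1)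
  | C1 i j n _ _ => mixed_extension i j 0 (n := n)
  | C2 i j n h _ _ _ => mixed_extension i j h (n := n)
  end.

(** ** Extension by the identity *)

Section IdentityExtension.
Implicit Types K H : Q -> Q.

Lemma identity_extension_val K x : identity_extension K (iota x) = iota (K x).
Proof.
apply: xget_unique; first by exists x.
by move=> _ [y /iota_inj-> <-].
Qed.

Variant identity_extension_spec K (p : P) : P -> Prop :=
| IdentityExtensionVal x of p = iota x :
    identity_extension_spec K p (iota (K x))
| IdentityExtensionId of (forall x, p <> iota x) :
    identity_extension_spec K p p.

Lemma identity_extensionP K p :
  identity_extension_spec K p (identity_extension K p).
Proof.
have [[x ->]|pN] := pselect (exists x, p = iota x).
  by rewrite identity_extension_val; exact: IdentityExtensionVal.
rewrite /identity_extension xgetPN => [|q [x /= xp _]]; last first.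
  by apply: pN; exists x.
by apply: IdentityExtensionId => x px; apply: pN; exists x.
Qed.

Lemma identity_extension_extensive K :
  extensive K -> extensive (identity_extension K).
Proof.
by move=> Ke p; case: identity_extensionP => [x ->|_//]; rewrite iota_embedding.
Qed.

Lemma identity_extension_contractive K :
  contractive K -> contractive (identity_extension K).
Proof.
by move=> Kc p; case: identity_extensionP => [x ->|_//]; rewrite iota_embedding.
Qed.

Lemma identity_extension_idempotent K :
  idempotent_fun K -> idempotent_fun (identity_extension K).
Proof.
move=> KK p /=; case: (identity_extensionP K p) => [x _|pN].
  by rewrite identity_extension_val; congr iota; exact: KK.
by case: identity_extensionP => // x /pN.
Qed.

Lemma identity_extension_involutive K :
  involutive K -> involutive (identity_extension K).
Proof.
move=> KK p; case: (identity_extensionP K p) => [x ->|pN].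
  by rewrite identity_extension_val KK.
by case: identity_extensionP => // x /pN.
Qed.

Lemma identity_extension_le K H : (forall x, K x <= H x) ->
  forall p, identity_extension K p <= identity_extension H p.
Proof.
move=> KH p; case: (identity_extensionP K p) => [x ->|pN].
  by rewrite identity_extension_val iota_embedding.
by case: identity_extensionP => // x /pN.
Qed.

End IdentityExtension.

(** ** The least mixed monotone extension *)

Section MixedExtension.
Context {n : nat}.
Implicit Types F H : operation n Q.

(** The tuple x is itself one of the tuples compatible with its image, and by
    mixed monotony no other one gives a larger value: the supremum is
    attained. *)
Lemma mixed_extension_val i j h F x : mixed_monotone i j F ->
  (forall (k : 'I_n) x, (k < h)%N -> x k <= F x) ->
  mixed_extension i j h F (iota \o x) = iota (F x).
Proof.
move=> Fm Fh; apply: supremum_max.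
  by left; exists x => // k; split.
move=> _ [[y yx <-]|[k kh <-]] /=; rewrite iota_embedding; last exact: Fh.
apply: mixed_monotone_le Fm _ => k; have [yx1 yx2 yx3] := yx k.
split=> [/yx1|/yx2|/yx3] /=; rewrite ?iota_embedding //.
exact: iota_inj.
Qed.

(** As h <= i <= n - j, the h arguments that are joined to the value are isotone
    arguments, hence harmless when an antitone argument varies. *)
Lemma mixed_extension_monotone i j h F : (i + j <= n)%N -> (h <= i)%N ->
  mixed_monotone i j (mixed_extension i j h F).
Proof.
move=> ijn hi; have inj : (i <= n - j)%N.
  by rewrite leq_subRL ?(leq_trans (leq_addl i j)) // addnC.
(* Moving the k-th argument in the right direction enlarges the set of
   compatible tuples and does not decrease any of the first h arguments. *)
have aux (k : 'I_n) p q : agree_off k p q ->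
    ((k < i)%N -> p k <= q k) -> ((n - j <= k)%N -> q k <= p k) ->
    ((k < i) || (n - j <= k))%N ->
    mixed_extension i j h F p <= mixed_extension i j h F q.
  move=> pq le_pq le_qp kij; apply: supremum_le => // _ [[x xp <-]|[l lh <-]].
    apply: le_supremum => //; left; exists x => // l.
    have [xp1 xp2 xp3] := xp l.
    have [lk|lk] := eqVneq l k; last by rewrite -pq.
    split=> [li|jl|/andP[il lj]].
    - by rewrite (le_trans (xp1 li)) // lk le_pq // -lk.
    - by rewrite (le_trans _ (xp2 jl)) // lk le_qp // -lk.
    - by move: kij; rewrite -lk ltnNge il leqNgt lj.
  apply: (@le_trans _ _ (q l)); last first.
    by apply: le_supremum => //; right; exists l.
  have [lk|/pq->//] := eqVneq l k.
  by rewrite lk; apply: le_pq; rewrite -lk (leq_trans lh).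
split=> k hk p q pq le_pq.
  apply: (aux k) => //; last by rewrite hk.
  by rewrite leqNgt (leq_trans hk inj).
apply: (aux k) => //; last by rewrite hk orbT.
  by move=> l lk; rewrite pq.
by move=> ki; move: (leq_trans ki (leq_trans inj hk)); rewrite ltnn.
Qed.

Lemma mixed_extension_ge i j h F (k : 'I_n) p :
  (k < h)%N -> p k <= mixed_extension i j h F p.
Proof. by move=> kh; apply: le_supremum => //; right; exists k. Qed.

Lemma mixed_extension_le i j h F H : (forall x, F x <= H x) ->
  forall p, mixed_extension i j h F p <= mixed_extension i j h H p.
Proof.
move=> FH p; apply: supremum_le => // _ [[x xp <-]|[k kh <-]].
  apply: (@le_trans _ _ (iota (H x))); first by rewrite iota_embedding.
  by apply: le_supremum => //; left; exists x.
exact: mixed_extension_ge.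
Qed.

End MixedExtension.

(** ** The least isotone extension of an interior operation *)

Section InteriorExtension.
Implicit Types F : operation 1 Q.

Lemma mixed_extension_contractive F : contractive (unary F) ->
  contractive (unary (mixed_extension 1 0 0 F)).
Proof.
move=> Fc p; apply: supremum_le => // _ [[x xp <-]|[]//].
have [/(_ isT) /= xp0 _ _] := xp ord0.
by apply: le_trans xp0; rewrite iota_embedding -unaryE.
Qed.

(** When iota x <= p, the point F x is open and its image is below the value G p
    at p of the extension, hence iota (F x) is also one of the points whose
    supremum is G (G p); so G p <= G (G p). *)
Lemma mixed_extension_interior F :
  contractive (unary F) -> idempotent_fun (unary F) ->
  idempotent_fun (unary (mixed_extension 1 0 0 F)).
Proof.
move=> Fc FF; set G := unary _ => p /=.
apply/eqP; rewrite eq_le mixed_extension_contractive //=.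
apply: supremum_le => // _ [[x xp <-]|[]//].
apply: le_supremum => //; left; exists (fun=> F x).
  move=> k; rewrite ord1 subn0; split=> // _ /=.
  by apply: le_supremum => //; left; exists x.
by congr iota; rewrite -[RHS]unaryE -FF /= unaryE.
Qed.

End InteriorExtension.

(** ** Isotone idempotent operations *)

Section RetractionExtension.
Implicit Types K H : Q -> Q.

Lemma retraction_extension_val K x :
  isotone K -> idempotent_fun K -> retraction_extension K (iota x) = iota (K x).
Proof.
move=> Ki KK; apply: infimum_min.
  exists (K x) => //; split=> [|y]; first exact: KK.
  by rewrite iota_embedding; exact: Ki.
by move=> _ [c [_ xc] <-]; rewrite iota_embedding xc.
Qed.

Lemma retraction_extension_isotone K : isotone (retraction_extension K).
Proof.
move=> p q pq; apply: le_infimum => // _ [c [Kc qc] <-].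
apply: infimum_le => //; exists c => //; split=> // x xp.
by apply: qc; exact: le_trans pq.
Qed.

(** The fixed points that bound the values below p are the same as those that
    bound the values below the extension at p. *)
Lemma retraction_extension_idempotent K :
  isotone K -> idempotent_fun K -> idempotent_fun (retraction_extension K).
Proof.
move=> Ki KK p /=; rewrite {1 3}/retraction_extension.
congr (infimum _ [set iota c | c in _]).
apply/seteqP; split=> c [Kc cP]; split=> // x xp.
  rewrite -[K x]KK; apply: cP.
  by apply: le_infimum => // _ [b [_ bP] <-]; rewrite iota_embedding bP.
rewrite -Kc; apply: Ki; rewrite -iota_embedding; apply: le_trans xp _.
by apply: infimum_le => //; exists c.
Qed.

(** A fixed point c of H need not be fixed by K, but K c <= H c = c is, and it
    bounds the values of K as soon as c bounds those of H. *)
Lemma retraction_extension_le K H :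
  isotone K -> idempotent_fun K -> (forall x, K x <= H x) ->
  forall p, retraction_extension K p <= retraction_extension H p.
Proof.
move=> Ki KK KH p; apply: le_infimum => // _ [c [Hc cP] <-].
apply: (@le_trans _ _ (iota (K c))); last by rewrite iota_embedding -{2}Hc.
apply: infimum_le => //; exists (K c) => //; split=> [|x xp]; first exact: KK.
by rewrite -[K x]KK; apply: Ki; apply: le_trans (KH x) (cP x xp).
Qed.

End RetractionExtension.

(** ** Closure operations *)

Section ClosureExtension.
Implicit Types K H : Q -> Q.

Lemma closure_extension_val K x :
  isotone K -> extensive K -> idempotent_fun K ->
  closure_extension K (iota x) = iota (K x).
Proof.
move=> Ki Ke KK; apply: infimum_min.
  exists (K x) => //; split; first exact: KK.
  by rewrite iota_embedding.
by move=> _ [c [Kc xc] <-]; rewrite iota_embedding -Kc Ki // -iota_embedding.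
Qed.

Lemma closure_extension_isotone K : isotone (closure_extension K).
Proof.
move=> p q pq; apply: le_infimum => // _ [c [Kc qc] <-].
by apply: infimum_le => //; exists c => //; split=> //; exact: le_trans qc.
Qed.

Lemma closure_extension_extensive K : extensive (closure_extension K).
Proof. by move=> p; apply: le_infimum => // _ [c [_ pc] <-]. Qed.

Lemma closure_extension_idempotent K : idempotent_fun (closure_extension K).
Proof.
move=> p /=; apply/eqP.
rewrite eq_le closure_extension_extensive andbT.
apply: le_infimum => // _ [c [Kc pc] <-].
apply: infimum_le => //; exists c => //; split=> //.
by apply: infimum_le => //; exists c.
Qed.

(** The larger a closure operation, the fewer closed points it has. *)
Lemma closure_extension_le K H : extensive K -> (forall x, K x <= H x) ->
  forall p, closure_extension K p <= closure_extension H p.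
Proof.
move=> Ke KH p; apply: le_infimum => // _ [c [Hc pc] <-].
apply: infimum_le => //; exists c => //; split=> //.
by apply/eqP; rewrite eq_le Ke andbT -{2}Hc.
Qed.

End ClosureExtension.

(** ** All properties together *)

Lemma extend_satisfies w (F : operation (arity w) Q) :
  satisfies F -> satisfies (extend F).
Proof.
case: w F => /=.
- by move=> F; exact: identity_extension_extensive.
- by move=> F; exact: identity_extension_contractive.
- by move=> F; exact: identity_extension_idempotent.
- move=> F [FF Fe]; split; first exact: identity_extension_idempotent.
  exact: identity_extension_extensive.
- move=> F [FF Fc]; split; first exact: identity_extension_idempotent.
  exact: identity_extension_contractive.
- by move=> F; exact: identity_extension_involutive.
- by move=> F _; apply/isotone_unaryP; exact: mixed_extension_monotone.
- move=> F _; split.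
    by apply/isotone_unaryP; exact: mixed_extension_monotone.
  by apply/extensive_unaryP => k p; exact: mixed_extension_ge.
- move=> F [_ Fc]; split; last exact: mixed_extension_contractive.
  by apply/isotone_unaryP; exact: mixed_extension_monotone.
- move=> F [Fi FF]; split; first exact: retraction_extension_isotone.
  exact: retraction_extension_idempotent.
- move=> F _; split; first exact: closure_extension_isotone.
    exact: closure_extension_extensive.
  exact: closure_extension_idempotent.
- move=> F [_ Fc FF]; split; last exact: mixed_extension_interior.
    by apply/isotone_unaryP; exact: mixed_extension_monotone.
  exact: mixed_extension_contractive.
- by move=> F _; apply/antitone_unaryP; exact: mixed_extension_monotone.
- by move=> i j n n0 ijn F _; exact: mixed_extension_monotone.
- move=> i j n h n0 ijn hi F _; split; first exact: mixed_extension_monotone.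
  by move=> k p; exact: mixed_extension_ge.
Qed.

Lemma extend_preserves w (F : operation (arity w) Q) :
  satisfies F -> preserves_operation iota F (extend F).
Proof.
have un (G : operation 1 Q) E :
    (forall x, E (iota x) = iota (unary G x)) ->
    preserves_operation iota G (unary_operation E).
  by move=> EG x; rewrite /unary_operation /= EG unaryE.
case: w F => /=.
1-6: by move=> F _; apply: un => x; exact: identity_extension_val.
- by move=> F /isotone_unaryP Fi x; rewrite mixed_extension_val.
- move=> F [/isotone_unaryP Fi /extensive_unaryP Fe] x.
  by rewrite mixed_extension_val.
- by move=> F [/isotone_unaryP Fi _] x; rewrite mixed_extension_val.
- by move=> F [Fi FF]; apply: un => x; exact: retraction_extension_val.
- by move=> F [Fi Fe FF]; apply: un => x; exact: closure_extension_val.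
- by move=> F [/isotone_unaryP Fi _ _] x; rewrite mixed_extension_val.
- by move=> F /antitone_unaryP Fa x; rewrite mixed_extension_val.
- by move=> i j n n0 ijn F Fm x; rewrite mixed_extension_val.
- by move=> i j n h n0 ijn hi F [Fm Fh] x; rewrite mixed_extension_val.
Qed.

Lemma extend_le w (F H : operation (arity w) Q) :
  satisfies F -> (forall x, F x <= H x) ->
  forall p, extend F p <= extend H p.
Proof.
move=> + FH p.
case: w F H FH p => [|||||||||||||i j n n0 ijn|i j n h n0 ijn hi] /= F H FH p.
1-6: by move=> _; apply: identity_extension_le => x; exact: FH.
- by move=> _; exact: mixed_extension_le.
- by move=> _; exact: mixed_extension_le.
- by move=> _; exact: mixed_extension_le.
- by move=> [Fi FF]; apply: retraction_extension_le => // x; exact: FH.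
- by move=> [_ Fe _]; apply: closure_extension_le => // x; exact: FH.
- by move=> _; exact: mixed_extension_le.
- by move=> _; exact: mixed_extension_le.
- by move=> _; exact: mixed_extension_le.
- by move=> _; exact: mixed_extension_le.
Qed.

Lemma extend_operation w (F : operation (arity w) Q) : satisfies F ->
  exists G : operation (arity w) P, satisfies G /\ preserves_operation iota F G.
Proof.
move=> FW; exists (extend F).
by split; [exact: extend_satisfies|exact: extend_preserves].
Qed.

Lemma extend_operations (I : property -> Type) (F : operations I Q) :
  all_satisfy F ->
  exists G : operations I P,
    [/\ all_satisfy G, preserves_operations iota F G &
        preserves_comparabilities F G].
Proof.
move=> FW; exists (fun w k => extend (F w k)); split=> w k.
- exact: extend_satisfies.
- exact: extend_preserves.
- by move=> l; exact: extend_le.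
Qed.

End Extension.

(** * The Dedekind-MacNeille completion *)

Section DedekindMacNeille.
Context {d : Order.disp_t} (Q : porderType d).

Definition is_cut (A : set Q) : bool := `[< lbound (ubound A) `<=` A >].

Definition macneille : Type := {A : set Q | is_cut A}.

HB.instance Definition _ := SubChoice.on macneille.
HB.instance Definition _ :=
  [SubChoice_isSubPOrder of macneille by <: with set_display].

Implicit Types (c e : macneille) (F : set macneille).

Lemma macneilleP c : lbound (ubound (val c)) `<=` val c.
Proof. by apply/asboolP; exact: valP c. Qed.

Lemma le_macneilleP c e : reflect (val c `<=` val e) (c <= e).
Proof. rewrite leEsub; exact: asboolP. Qed.

Lemma cut_subproof (A : set Q) : is_cut (lbound (ubound A)).
Proof. by apply/asboolP => x xA y Ay; apply: xA => z; apply. Qed.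

(** The least cut that contains A: lbound \o ubound is the closure operator of a
    Galois connection. *)
Definition cut (A : set Q) : macneille :=
  Sub (lbound (ubound A)) (cut_subproof A).

Lemma sub_cut (A : set Q) : A `<=` val (cut A).
Proof. by rewrite SubK => x Ax y; apply. Qed.

Lemma cut_le (A : set Q) e : A `<=` val e -> cut A <= e.
Proof.
move=> Ae; apply/le_macneilleP; rewrite SubK => x xA.
by apply: macneilleP => y ey; apply: xA => z /Ae; apply: ey.
Qed.

Definition macneille_sup F : macneille :=
  cut [set x | exists2 c, F c & val c x].

(** Intersections of cuts are cuts; closing up under [cut] only saves a proof of
    it, and adds no point by [cut_le]. *)
Definition macneille_inf F : macneille :=
  cut [set x | forall c, F c -> val c x].

Lemma macneille_supP F : supremums F (macneille_sup F).
Proof.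
split=> [c Fc|e eF].
  by apply/le_macneilleP => x cx; apply: sub_cut; exists c.
by apply: cut_le => x [c /eF /le_macneilleP]; apply.
Qed.

Lemma macneille_infP F : infimums F (macneille_inf F).
Proof.
split=> [c Fc|e eF]; first by apply: cut_le => x; apply.
apply/le_macneilleP => x ex; apply: sub_cut => c /eF /le_macneilleP; exact.
Qed.

Lemma macneille_meetP c e1 e2 :
  (c <= macneille_inf [set e1; e2]) = (c <= e1) && (c <= e2).
Proof.
have [lb glb] := macneille_infP [set e1; e2].
apply/idP/andP => [ce|[ce1 ce2]]; last by apply: glb => _ [->|->].
by split; apply: le_trans ce _; apply: lb; [left|right].
Qed.

Lemma macneille_joinP e1 e2 c :
  (macneille_sup [set e1; e2] <= c) = (e1 <= c) && (e2 <= c).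
Proof.
have [ub lub] := macneille_supP [set e1; e2].
apply/idP/andP => [ce|[ce1 ce2]]; last by apply: lub => _ [->|->].
by split; apply: le_trans ce; apply: ub; [left|right].
Qed.

Lemma macneille_le0 c : macneille_sup set0 <= c.
Proof. by case: (macneille_supP set0) => _; apply. Qed.

Lemma macneille_le1 c : c <= macneille_inf set0.
Proof. by case: (macneille_infP set0) => _; apply. Qed.

HB.instance Definition _ := Order.POrder_MeetJoin_isLattice.Build set_display
  macneille macneille_meetP macneille_joinP.
HB.instance Definition _ :=
  Order.hasBottom.Build set_display macneille macneille_le0.
HB.instance Definition _ :=
  Order.hasTop.Build set_display macneille macneille_le1.

Lemma macneille_complete : complete macneille.
Proof.
move=> F; split; first by exists (macneille_sup F); exact: macneille_supP.
by exists (macneille_inf F); exact: macneille_infP.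
Qed.

Definition principal (x : Q) : macneille := cut [set x].

Lemma mem_principal x y : val (principal x) y <-> y <= x.
Proof.
rewrite SubK; split=> [|yx z]; first by apply=> _ ->.
by move=> /(_ x erefl); exact: le_trans.
Qed.

Lemma principal_le x c : (principal x <= c) <-> val c x.
Proof.
split=> [/le_macneilleP xc|cx]; last by apply: cut_le => _ ->.
by apply: xc; apply: sub_cut.
Qed.

Lemma principal_embedding :
  [/\ order_embedding principal, preserves_meets principal &
      preserves_joins principal].
Proof.
have princ_le : order_embedding principal.
  by move=> x y; apply/idP/idP => [/principal_le | ] /mem_principal //
    /principal_le.
split=> // A s [As sA].
  split=> [_ [a Aa <-]|c cA]; first by rewrite princ_le As.
  apply/le_macneilleP => x cx; apply/mem_principal/sA => a Aa.
  rewrite -princ_le; apply: le_trans (cA _ _); last by exists a.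
  exact/principal_le.
split=> [_ [a Aa <-]|c cA]; first by rewrite princ_le As.
apply/principal_le/macneilleP => x cx; apply: sA => a Aa.
by apply: cx; apply/principal_le/cA; exists a.
Qed.

End DedekindMacNeille.

(** * Embeddings into powersets *)

Section Powersets.

Lemma set_complete_atomic (T : Type) : complete_atomic (set T).
Proof.
split=> [F|A A0].
  split.
    exists (\bigcup_(A in F) A); split=> [A FA|B BF].
      by apply/asboolP => x Ax; exists A.
    by apply/asboolP => x [A /BF/asboolP]; apply.
  exists (\bigcap_(A in F) A); split=> [A FA|B BF].
    by apply/asboolP => x; apply.
  by apply/asboolP => x Bx A /BF/asboolP; apply.
have /set0P[x Ax] : A != set0 by [].
exists [set x]; last by apply/asboolP => _ ->.
split=> [|B]; first by apply/set0P; exists x.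
rewrite lt_neqAle => /andP[Bx /asboolP/subset_set1[//|B1]].
by rewrite B1 eqxx in Bx.
Qed.

Context {d : Order.disp_t} (Q : porderType d).

Definition lower_set (x : Q) : set Q := [set y | y <= x].
Definition nonupper_set (x : Q) : set Q := [set y | ~~ (x <= y)].

Lemma lower_set_embedding :
  order_embedding lower_set /\ preserves_meets lower_set.
Proof.
have low_le : order_embedding lower_set.
  move=> x y; apply/asboolP/idP => [|xy z zx]; last exact: le_trans xy.
  by apply; rewrite /lower_set /=.
split=> // A s [sA As]; split=> [_ [a Aa <-]|B BA]; first by rewrite low_le sA.
apply/asboolP => x Bx; apply: As => a Aa.
by have /asboolP := BA (lower_set a) (imageP _ Aa); apply.
Qed.

Lemma nonupper_set_embedding :
  order_embedding nonupper_set /\ preserves_joins nonupper_set.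
Proof.
have nonup_le : order_embedding nonupper_set.
  move=> x y; apply/asboolP/idP => [xy|xy z]; last first.
    by apply: contraNN; exact: le_trans.
  by apply: contraT => /xy; rewrite /nonupper_set /= lexx.
split=> // A s [As sA].
split=> [_ [a Aa <-]|B BA]; first by rewrite nonup_le As.
apply/asboolP => x; apply: contraNP => Bx; apply: sA => a Aa.
apply: contraT => ax; case: Bx.
by have /asboolP := BA (nonupper_set a) (imageP _ Aa); apply.
Qed.

End Powersets.

(** * Prime filters of a distributive lattice *)

Section PrimeFilters.
Context {d : Order.disp_t} (Q : distrLatticeType d).
Implicit Types (A : set Q) (x y u v : Q).

(** The empty set and the whole lattice are allowed, also as prime filters: an
    improper prime filter never separates two points, and since top and bottom
    need not be preserved it does no harm in the spectrum. *)
Definition lattice_filter A : Prop := forall u v, A (u `&` v) <-> A u /\ A v.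

Definition prime_filter A : Prop :=
  lattice_filter A /\ forall u v, A (u `|` v) <-> A u \/ A v.

Lemma lattice_filter_up A u v : lattice_filter A -> u <= v -> A u -> A v.
Proof. by move=> Af /meet_idPl uv; rewrite -{1}uv => /Af[]. Qed.

(** The prime filter theorem: a filter that is maximal among those avoiding y
    is prime by distributivity.  Zorn's lemma needs the empty chain to have an
    upper bound, so the filters are not required to contain x from the start;
    instead no element may meet x below y, and then x belongs to the maximal
    filter. *)
Lemma prime_filter_separation x y :
  ~~ (x <= y) -> exists A, [/\ prime_filter A, A x & ~ A y].
Proof.
move=> xy.
pose avoiding A := lattice_filter A /\ forall a, A a -> ~~ (x `&` a <= y).
have [|A [[Af Axy] Amax]] := @Zorn_bigcup Q avoiding.
  move=> F Favoid Ftot; split=> [u v|a [A /Favoid[_]]]; last by apply.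
  split=> [[A FA]|[[A FA Au] [B FB Bv]]].
    by move=> /(Favoid A FA).1[Au Av]; split; exists A.
  have [AB|BA] := Ftot A B FA FB.
    by exists B => //; apply/(Favoid B FB).1; split=> //; exact: AB.
  by exists A => //; apply/(Favoid A FA).1; split=> //; exact: BA.
have extend_filter u : ~ A u ->
    x `&` u <= y \/ exists2 a, A a & x `&` (a `&` u) <= y.
  move=> Au; apply: contrapT => /not_orP[xuy xauy].
  (* the filter generated by u and A, also when A is empty *)
  pose B := [set t | u <= t \/ exists2 a, A a & a `&` u <= t].
  apply: (Amax B).
    split=> [t At|/(_ u) BA]; last by apply/Au/BA; left.
    by right; exists t => //; exact: leIl.
  split=> [s t|t Bt].
    split=> [[|[a Aa]]|]; rewrite ?lexI.
    - by move=> /andP[us ut]; split; left.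
    - by move=> /andP[aus aut]; split; right; exists a.
    - move=> [[us|[a Aa aus]] [ut|[b Ab but]]].
      + by left; rewrite lexI us.
      + right; exists b => //; rewrite lexI but andbT.
        by apply: le_trans us; exact: leIr.
      + right; exists a => //; rewrite lexI aus /=.
        by apply: le_trans ut; exact: leIr.
      + right; exists (a `&` b); first exact/Af.
        rewrite lexI (le_trans _ aus) ?(le_trans _ but) //; last first.
          by rewrite leI2 // leIl.
        by rewrite leI2 // leIr.
  apply/negP => xty; case: Bt => [ut|[a Aa aut]].
    by apply: xuy; apply: le_trans xty; rewrite leI2.
  by apply: xauy; exists a => //; apply: le_trans xty; rewrite leI2.
have Ax : A x.
  apply: contrapT => /extend_filter[|[a /Axy/negP axy]].
    by rewrite meetxx; apply/negP.
  by rewrite meetCA meetxx meetC => /axy.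
have outside u : ~ A u -> exists2 a, A a & a `&` u <= y.
  move=> /extend_filter[xuy|[a Aa xauy]]; first by exists x.
  by exists (x `&` a); [exact/Af|rewrite -meetA].
exists A; split=> //; last first.
  by move=> /Axy; rewrite leIr.
split=> // u v; split=> [Auv|[]]; last 2 first.
- exact: lattice_filter_up Af (leUl _ _).
- exact: lattice_filter_up Af (leUr _ _).
apply: contrapT => /not_orP[/outside[a Aa auy] /outside[b Ab bvy]].
have /Axy/negP : A ((a `&` b) `&` (u `|` v)) by apply/Af; split=> //; exact/Af.
apply; apply: le_trans (leIr _ _) _; rewrite meetUr leUx.
apply/andP; split; [apply: le_trans auy|apply: le_trans bvy].
  by rewrite leI2 // leIl.
by rewrite leI2 // leIr.
Qed.

Definition prime_spectrum x : set (set Q) := [set A | prime_filter A /\ A x].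

Lemma prime_spectrum_embedding : lattice_embedding prime_spectrum.
Proof.
split=> [x y|x y|x y].
- apply/asboolP/idP => [sub_xy|xy A [Ap Ax]]; last first.
    by split=> //; exact: lattice_filter_up Ap.1 xy Ax.
  apply: contraT => /prime_filter_separation[A [Ap Ax]].
  by have [] := sub_xy A (conj Ap Ax).
- apply/seteqP; split=> [A [Ap /Ap.1[]]|A [[Ap Ax] [_ Ay]]]; first by [].
  by split=> //; exact/Ap.1.
- apply/seteqP; split=> [A [Ap /Ap.2[]]|A [[Ap Ax]|[Ap Ay]]].
  + by left.
  + by right.
  + by split=> //; apply/Ap.2; left.
  + by split=> //; apply/Ap.2; right.
Qed.

End PrimeFilters.

Theorem corollary3p5 (W : property) :
  (* (1) *)
  (forall (d : Order.disp_t) (Q : porderType d) (F : operation (arity W) Q)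
      (d' : Order.disp_t) (P : tbLatticeType d') (iota : Q -> P),
    satisfies F -> complete P -> order_embedding iota ->
    exists G : operation (arity W) P,
      satisfies G /\ preserves_operation iota F G) /\
  (* (2) *)
  (forall (d : Order.disp_t) (Q : porderType d) (F : operation (arity W) Q),
    satisfies F ->
    exists (d' : Order.disp_t) (P : tbLatticeType d')
        (G : operation (arity W) P) (iota : Q -> P),
      complete P /\ satisfies G /\ order_embedding iota /\
      preserves_operation iota F G /\
      preserves_meets iota /\ preserves_joins iota) /\
  (* (3) *)
  (forall (d : Order.disp_t) (Q : porderType d) (F : operation (arity W) Q),
    satisfies F ->
    (exists (d' : Order.disp_t) (P : ctbDistrLatticeType d')
        (G : operation (arity W) P) (iota : Q -> P),
      complete_atomic P /\ satisfies G /\ order_embedding iota /\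
      preserves_operation iota F G /\ preserves_meets iota) /\
    (exists (d' : Order.disp_t) (P : ctbDistrLatticeType d')
        (G : operation (arity W) P) (iota : Q -> P),
      complete_atomic P /\ satisfies G /\ order_embedding iota /\
      preserves_operation iota F G /\ preserves_joins iota)) /\
  (* (4) *)
  (forall (d : Order.disp_t) (Q : distrLatticeType d)
      (F : operation (arity W) Q),
    satisfies F ->
    exists (d' : Order.disp_t) (P : ctbDistrLatticeType d')
        (G : operation (arity W) P) (iota : Q -> P),
      complete_atomic P /\ satisfies G /\ lattice_embedding iota /\
      preserves_operation iota F G) /\
  (* (5) *)
  (forall I : property -> Type,
    (* (5), case (1) *)
    (forall (d : Order.disp_t) (Q : porderType d) (F : operations I Q)
        (d' : Order.disp_t) (P : tbLatticeType d') (iota : Q -> P),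
      all_satisfy F -> complete P -> order_embedding iota ->
      exists G : operations I P,
        all_satisfy G /\ preserves_operations iota F G /\
        preserves_comparabilities F G) /\
    (* (5), case (2) *)
    (forall (d : Order.disp_t) (Q : porderType d) (F : operations I Q),
      all_satisfy F ->
      exists (d' : Order.disp_t) (P : tbLatticeType d')
          (G : operations I P) (iota : Q -> P),
        complete P /\ all_satisfy G /\ order_embedding iota /\
        preserves_operations iota F G /\ preserves_comparabilities F G /\
        preserves_meets iota /\ preserves_joins iota) /\
    (* (5), case (3) *)
    (forall (d : Order.disp_t) (Q : porderType d) (F : operations I Q),
      all_satisfy F ->
      (exists (d' : Order.disp_t) (P : ctbDistrLatticeType d')
          (G : operations I P) (iota : Q -> P),
        complete_atomic P /\ all_satisfy G /\ order_embedding iota /\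
        preserves_operations iota F G /\ preserves_comparabilities F G /\
        preserves_meets iota) /\
      (exists (d' : Order.disp_t) (P : ctbDistrLatticeType d')
          (G : operations I P) (iota : Q -> P),
        complete_atomic P /\ all_satisfy G /\ order_embedding iota /\
        preserves_operations iota F G /\ preserves_comparabilities F G /\
        preserves_joins iota)) /\
    (* (5), case (4) *)
    (forall (d : Order.disp_t) (Q : distrLatticeType d) (F : operations I Q),
      all_satisfy F ->
      exists (d' : Order.disp_t) (P : ctbDistrLatticeType d')
          (G : operations I P) (iota : Q -> P),
        complete_atomic P /\ all_satisfy G /\ lattice_embedding iota /\
        preserves_operations iota F G /\ preserves_comparabilities F G)).
Proof.
split; [|split; [|split; [|split; [|split; [|split; [|split]]]]]].
- by move=> d Q F d' P iota FW Pc iotaP; exact: extend_operation.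
- move=> d Q F FW.
  have [princ_le princ_meets princ_joins] := principal_embedding Q.
  have Pc : complete (macneille Q) by exact: macneille_complete.
  have [G [GW FG]] := extend_operation princ_le Pc FW.
  by exists set_display, (macneille Q), G, (@principal _ Q).
- move=> d Q F FW.
  have [Pc Pa] := set_complete_atomic Q; split.
    have [low_le low_meets] := lower_set_embedding Q.
    have [G [GW FG]] := extend_operation low_le Pc FW.
    by exists set_display, (set Q), G, (@lower_set _ Q).
  have [nonup_le nonup_joins] := nonupper_set_embedding Q.
  have [G [GW FG]] := extend_operation nonup_le Pc FW.
  by exists set_display, (set Q), G, (@nonupper_set _ Q).
- move=> d Q F FW.
  have [Pc Pa] := set_complete_atomic (set Q).
  have specP := prime_spectrum_embedding Q; have [spec_le _ _] := specP.
  have [G [GW FG]] := extend_operation spec_le Pc FW.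
  by exists set_display, (set (set Q)), G, (@prime_spectrum _ Q).
- move=> d Q F d' P iota FW Pc iotaP.
  by have [G []] := extend_operations iotaP Pc FW; exists G.
- move=> d Q F FW.
  have [princ_le princ_meets princ_joins] := principal_embedding Q.
  have Pc : complete (macneille Q) by exact: macneille_complete.
  have [G [GW FG leG]] := extend_operations princ_le Pc FW.
  by exists set_display, (macneille Q), G, (@principal _ Q).
- move=> d Q F FW.
  have [Pc Pa] := set_complete_atomic Q; split.
    have [low_le low_meets] := lower_set_embedding Q.
    have [G [GW FG leG]] := extend_operations low_le Pc FW.
    by exists set_display, (set Q), G, (@lower_set _ Q).
  have [nonup_le nonup_joins] := nonupper_set_embedding Q.
  have [G [GW FG leG]] := extend_operations nonup_le Pc FW.
  by exists set_display, (set Q), G, (@nonupper_set _ Q).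
- move=> d Q F FW.
  have [Pc Pa] := set_complete_atomic (set Q).
  have specP := prime_spectrum_embedding Q; have [spec_le _ _] := specP.
  have [G [GW FG leG]] := extend_operations spec_le Pc FW.
  by exists set_display, (set (set Q)), G, (@prime_spectrum _ Q).
Qed.
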